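(* Suppose that Assumption A holds (see context). Then, for each $k\ge0$, the line search criterion $$\mathcal{F}_\lambda(U,V)-\mathcal{R}_k\le-\frac c2\left(\|U-X^k\|_F^2+\|V-Y^k\|_F^2\right)$$ in step (2c) of the A-NAUM algorithm (see context) is satisfied after finitely many inner iterations (i.e. after finitely many passes through steps (2a)–(2d) at iteration $k$).
   Context: **Setting.** $r\le n$, $q\le n^2$, $\bm{b}\in\mathbb{R}^q$, $\lambda\ge0$, $\mathcal{A}:\mathbb{R}^{n\times n}\to\mathbb{R}^q$ linear with adjoint $\mathcal{A}^*$; $\Psi,\Phi:\mathbb{R}^{n\times r}\to\mathbb{R}\cup\{+\infty\}$; $$\mathcal{F}_\lambda(X,Y):=\Psi(X)+\Phi(Y)+\tfrac12\|\mathcal{A}(XY^\top)-\bm{b}\|^2+\tfrac{\lambda}{2}\|X-Y\|_F^2,\quad X,Y\in\mathbb{R}^{n\times r}.$$ $\|\cdot\|$ is the Euclidean norm for vectors, spectral norm for matrices, operator norm for linear maps on $(\mathbb{R}^{n\times n},\|\cdot\|_F)$; $\mathcal{I}_q,\mathcal{I}$ are the identities on $\mathbb{R}^q$, $\mathbb{R}^{n\times n}$. Lowercase bold letters denote columns, e.g. $X=[\bm{x}_1,\dots,\bm{x}_r]$. Closed means lower semicontinuous; level-bounded means all sublevel sets are bounded. **Assumption A.** (i) $\Psi$ (or $\psi_i$ for all $i$ if $\Psi(X)=\sum_{i=1}^r\psi_i(\bm{x}_i)$) and $\Phi$ (or $\phi_i$ for all $i$ if $\Phi(Y)=\sum_{i=1}^r\phi_i(\bm{y}_i)$)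 are proper closed and bounded from below; (ii) $\mathcal{A}\mathcal{A}^*=\mathcal{I}_q$; (iii) $\frac1\alpha+\frac1\beta=1$; (iv) when $\lambda=0$, $\mathcal{F}_0$ is level-bounded. **Update schemes.** Let $\mathcal{H}_\alpha(X,Y,Z):=\frac{\alpha}{2}\|XY^\top-Z\|_F^2$. Given $X^k,Y^k,Z^k$ and $\mu_k,\sigma_k>0$, $U$ is computed by one of: (U1) $U\in\arg\min_X\Psi(X)+\mathcal{H}_\alpha(X,Y^k,Z^k)+\frac\lambda2\|X-Y^k\|_F^2+\frac{\mu_k}{2}\|X-X^k\|_F^2$; (U2) $U\in\arg\min_X\Psi(X)+\langle\nabla_X\mathcal{H}_\alpha(X^k,Y^k,Z^k),X-X^k\rangle+\frac\lambda2\|X-Y^k\|_F^2+\frac{\mu_k}{2}\|X-X^k\|_F^2$; (U3) (if $\Psi(X)=\sum_i\psi_i(\bm{x}_i)$) successively for $i=1,\dots,r$: $\bm{u}_i\in\arg\min_{\bm{x}_i}\psi_i(\bm{x}_i)+\frac\alpha2\|\sum_{j<i}\bm{u}_j(\bm{y}_j^k)^\top+\bm{x}_i(\bm{y}_i^k)^\top+\sum_{j>i}\bm{x}_j^k(\bm{y}_j^k)^\top-Z^k\|_F^2+\frac\lambda2\|\bm{x}_i-\bm{y}_i^k\|^2+\frac{\mu_k}{2}\|\bm{x}_i-\bm{x}_i^k\|^2$. Then $V$ is computed by one of: (V1) $V\in\arg\min_Y\Phi(Y)+\mathcal{H}_\alpha(U,Y,Z^k)+\frac\lambda2\|U-Y\|_F^2+\frac{\sigma_k}{2}\|Y-Y^k\|_F^2$;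 (V2) $V\in\arg\min_Y\Phi(Y)+\langle\nabla_Y\mathcal{H}_\alpha(U,Y^k,Z^k),Y-Y^k\rangle+\frac\lambda2\|U-Y\|_F^2+\frac{\sigma_k}{2}\|Y-Y^k\|_F^2$; (V3) (if $\Phi(Y)=\sum_i\phi_i(\bm{y}_i)$) successively for $i=1,\dots,r$: $\bm{v}_i\in\arg\min_{\bm{y}_i}\phi_i(\bm{y}_i)+\frac\alpha2\|\sum_{j<i}\bm{u}_j\bm{v}_j^\top+\bm{u}_i\bm{y}_i^\top+\sum_{j>i}\bm{u}_j(\bm{y}_j^k)^\top-Z^k\|_F^2+\frac\lambda2\|\bm{u}_i-\bm{y}_i\|^2+\frac{\sigma_k}{2}\|\bm{y}_i-\bm{y}_i^k\|^2$. **Algorithm (A-NAUM).** Input: $(X^0,Y^0)\in\mathrm{dom}\,\mathcal{F}_\lambda$; $\alpha,\beta$ with $\frac1\alpha+\frac1\beta=1$; $\mu^{\min}>0$, $0<\sigma^{\min}<\sigma^{\max}<\infty$, $\tau>1$, $c>0$, $0<p_{\min}<1$; $\rho:=\|\mathcal{I}-\frac{\beta}{\alpha+\beta}\mathcal{A}^*\mathcal{A}\|^2$; $\gamma\ge0$ with $(\alpha+\gamma)\mathcal{I}+\beta\mathcal{A}^*\mathcal{A}\succeq0$. Set $\mathcal{R}_0=\mathcal{F}_\lambda(X^0,Y^0)$. For $k=0,1,2,\dots$ (run indefinitely): Step 1. $Z^k=(\mathcal{I}-\frac{\beta}{\alpha+\beta}\mathcal{A}^*\mathcal{A})(X^k(Y^k)^\top)+\frac{\beta}{\alpha+\beta}\mathcal{A}^*(\bm{b})$.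 Step 2. Choose $\mu_k^0\ge\mu^{\min}$, $\sigma_k^0\in[\sigma^{\min},\sigma^{\max}]$ arbitrarily; set $\mu_k=\mu_k^0$, $\sigma_k=\sigma_k^0$, $\mu_k^{\max}=(\alpha+2\gamma\rho)\|Y^k\|^2+c$. (2a) Set $\mu_k\leftarrow\min\{\mu_k,\mu_k^{\max}\}$; compute $U$ by either (U1), (U2) or (U3). (2b) Compute $V$ by either (V1), (V2) or (V3). (2c) If $\mathcal{F}_\lambda(U,V)-\mathcal{R}_k\le-\frac c2(\|U-X^k\|_F^2+\|V-Y^k\|_F^2)$, go to Step 3. (2d) If $\mu_k=\mu_k^{\max}$, set $\sigma_k^{\max}=(\alpha+2\gamma\rho)\|U\|^2+c$, $\sigma_k\leftarrow\min\{\tau\sigma_k,\sigma_k^{\max}\}$ and go to (2b); otherwise set $\mu_k\leftarrow\tau\mu_k$, $\sigma_k\leftarrow\tau\sigma_k$ and go to (2a). Step 3. Set $X^{k+1}=U$, $Y^{k+1}=V$, $\bar\mu_k=\mu_k$, $\bar\sigma_k=\sigma_k$; choose $p_{k+1}\in[p_{\min},1]$ and set $\mathcal{R}_{k+1}=(1-p_{k+1})\mathcal{R}_k+p_{k+1}\mathcal{F}_\lambda(X^{k+1},Y^{k+1})$.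
   Formalization: The formal theorem adds: if α<0, the line search at iteration k uses only the prox-linear updates (U2) and (V2); for α<0 with (U1)/(U3) or (V1)/(V3) the claim can fail (e.g. n=r=q=1, A=id, α=-1, β=γ=1/2). For α>0 all schemes are covered. *)

(* Defs.v *)
From HB Require Import structures.
From mathcomp Require Import all_boot all_order all_algebra.
From mathcomp Require Import all_classical all_reals all_analysis.

Set Implicit Arguments.
Unset Strict Implicit.
Unset Printing Implicit Defensive.

Import Order.TTheory GRing.Theory Num.Theory.
Import numFieldNormedType.Exports.

Local Open Scope classical_set_scope.
Local Open Scope ring_scope.

Section Norms.
Context {R : realType}.

(* On columns, [mxdot] and [frob] are the Euclidean inner product and norm.
   The library's [`|X|] on matrices is the max norm, so it is not used here. *)
Definition mxdot {m n} (X Y : 'M[R]_(m, n)) : R := \tr (X^T *m Y).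

Definition frob {m n} (X : 'M[R]_(m, n)) : R := Num.sqrt (mxdot X X).

Definition opnorm {m n m' n'} (L : 'M[R]_(m, n) -> 'M[R]_(m', n')) : R :=
  sup [set frob (L X) | X in [set X | frob X <= 1]].

Definition specnorm {m n} (Y : 'M[R]_(m, n)) : R :=
  opnorm (fun x : 'cV[R]_n => Y *m x).

Definition adjoint {n q} (A : {linear 'M[R]_n -> 'cV[R]_q}) (w : 'cV[R]_q) :
    'M[R]_n := \matrix_(i, j) mxdot (A (delta_mx i j)) w.

Lemma mxdotE m n (X Y : 'M[R]_(m, n)) : mxdot X Y = \sum_i \sum_j X i j * Y i j.
Proof.
rewrite /mxdot /mxtrace exchange_big /=; apply: eq_bigr => j _.
by rewrite !mxE; apply: eq_bigr => i _; rewrite !mxE.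
Qed.

Lemma adjointP n q (A : {linear 'M[R]_n -> 'cV[R]_q}) X w :
  mxdot (A X) w = mxdot X (adjoint A w).
Proof.
rewrite [RHS]mxdotE {1}(matrix_sum_delta X) linear_sum /mxdot.
rewrite linear_sum /= mulmx_suml linear_sum /=; apply: eq_bigr => i _.
rewrite linear_sum linear_sum /= mulmx_suml linear_sum /=.
apply: eq_bigr => j _.
by rewrite linearZ linearZ /= -scalemxAl linearZ /= mxE.
Qed.

Definition gradient {m n} (f : 'M[R]_(m, n) -> R) (X : 'M[R]_(m, n)) :
    'M[R]_(m, n) := \matrix_(i, j) 'D_(delta_mx i j) f X.

End Norms.

Section ExtendedFunctions.
Context {R : realType}.
Local Open Scope ereal_scope.

Definition is_argmin {T : Type} (f : T -> \bar R) (x : T) : Prop :=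
  forall y, f x <= f y.

(* Properness includes that the values lie in R u {+oo}. *)
Definition proper {T : Type} (f : T -> \bar R) : Prop :=
  (forall x, f x != -oo) /\ (exists x, f x != +oo).

Definition bounded_from_below {T : Type} (f : T -> \bar R) : Prop :=
  exists m : R, forall x, m%:E <= f x.

Definition proper_closed_bounded {m n} (f : 'M[R]_(m, n) -> \bar R) : Prop :=
  [/\ proper f, lower_semicontinuous f & bounded_from_below f].

(* [Separable psi] is the function X |-> \sum_i psi_i (x_i) given together with
   its splitting over the columns of X; [General f] is f without a splitting. *)
Inductive regularizer (n r : nat) :=
  | General of ('M[R]_(n, r) -> \bar R)
  | Separable of ('I_r -> 'cV[R]_n -> \bar R).

Definition reg_val n r (Psi : regularizer n r) (X : 'M[R]_(n, r)) : \bar R :=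
  match Psi with
  | General f => f X
  | Separable psi => \sum_(i < r) psi i (col i X)
  end.

Definition reg_proper_closed_bounded n r (Psi : regularizer n r) : Prop :=
  match Psi with
  | General f => proper_closed_bounded f
  | Separable psi => forall i, proper_closed_bounded (psi i)
  end.

End ExtendedFunctions.

Arguments regularizer R n r : clear implicits.
Coercion reg_val : regularizer >-> Funclass.

Record problem (R : realType) (n r q : nat) := MkProblem {
  Psi : regularizer R n r;
  Phi : regularizer R n r;
  opA : {linear 'M[R]_n -> 'cV[R]_q};
  vecb : 'cV[R]_q;
  lambda : R
}.

Record parameters (R : realType) := MkParameters {
  alpha : R; beta : R; gamma : R;
  mu_min : R; sigma_min : R; sigma_max : R;
  tau : R; c : R; p_min : R
}.

Inductive scheme := Proximal | ProxLinear | HierarchicalProx.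

(* One inner iteration: the state when the line search criterion is tested,
   with the scheme that produced each candidate. *)
Record pass (R : realType) (n r : nat) := MkPass {
  mu : R; sigma : R;
  Uby : scheme; Vby : scheme;
  candU : 'M[R]_(n, r); candV : 'M[R]_(n, r)
}.

Section ANAUM.
Context {R : realType} {n r q : nat}.
Variables (P : problem R n r q) (T : parameters R).

Local Notation Psi := (Psi P).
Local Notation Phi := (Phi P).
Local Notation A := (opA P).
Local Notation Aadj := (adjoint (opA P)).
Local Notation b := (vecb P).
Local Notation lam := (lambda P).
Local Notation alpha := (alpha T).
Local Notation beta := (beta T).
Local Notation gamma := (gamma T).
Local Notation c := (c T).
Local Notation mat := 'M[R]_(n, r).

Definition objective (X Y : mat) : \bar R :=
  (Psi X + Phi Y
   + (2^-1 * frob (A (X *m Y^T) - b) ^+ 2 + lam / 2 * frob (X - Y) ^+ 2)%:E)%E.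

(* The conditions [alpha != 0] and [beta != 0] are implicit in the equation
   1/alpha + 1/beta = 1; they are needed here because 0^-1 = 0. *)
Definition assumptionA : Prop :=
  [/\ reg_proper_closed_bounded Psi /\ reg_proper_closed_bounded Phi,
      forall w, A (Aadj w) = w,
      [/\ alpha != 0, beta != 0 & alpha^-1 + beta^-1 = 1]
    & lam = 0 -> forall a : R,
        bounded_set [set XY : mat * mat | (objective XY.1 XY.2 <= a%:E)%E]].

Definition valid_parameters : Prop :=
  [/\ 0 < mu_min T,
      0 < sigma_min T < sigma_max T,
      1 < tau T, 0 < c & 0 < p_min T < 1]
  /\ (0 <= gamma /\
      forall W : 'M[R]_n,
        0 <= mxdot W ((alpha + gamma) *: W + beta *: Aadj (A W))).

Definition H (X Y : mat) (Z : 'M[R]_n) : R :=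
  alpha / 2 * frob (X *m Y^T - Z) ^+ 2.

Definition Uupdate (s : scheme) (Xk Yk : mat) (Zk : 'M[R]_n) (mu : R)
    (U : mat) : Prop :=
  match s with
  | Proximal => is_argmin (fun X : mat =>
      (Psi X + (H X Yk Zk + lam / 2 * frob (X - Yk) ^+ 2
                + mu / 2 * frob (X - Xk) ^+ 2)%:E)%E) U
  | ProxLinear => is_argmin (fun X : mat =>
      (Psi X + (mxdot (gradient (fun X' => H X' Yk Zk) Xk) (X - Xk)
                + lam / 2 * frob (X - Yk) ^+ 2
                + mu / 2 * frob (X - Xk) ^+ 2)%:E)%E) U
  | HierarchicalProx => exists2 psi, Psi = Separable psi &
      forall i : 'I_r, is_argmin (fun x : 'cV[R]_n =>
        (psi i x
         + (alpha / 2 * frob (\sum_(j < r | (j < i)%N) col j U *m (col j Yk)^T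
                              + x *m (col i Yk)^T
                              + \sum_(j < r | (i < j)%N)
                                  col j Xk *m (col j Yk)^T
                              - Zk) ^+ 2
            + lam / 2 * frob (x - col i Yk) ^+ 2
            + mu / 2 * frob (x - col i Xk) ^+ 2)%:E)%E) (col i U)
  end.

Definition Vupdate (s : scheme) (U Yk : mat) (Zk : 'M[R]_n) (sigma : R)
    (V : mat) : Prop :=
  match s with
  | Proximal => is_argmin (fun Y : mat =>
      (Phi Y + (H U Y Zk + lam / 2 * frob (U - Y) ^+ 2
                + sigma / 2 * frob (Y - Yk) ^+ 2)%:E)%E) V
  | ProxLinear => is_argmin (fun Y : mat =>
      (Phi Y + (mxdot (gradient (fun Y' => H U Y' Zk) Yk) (Y - Yk)
                + lam / 2 * frob (U - Y) ^+ 2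
                + sigma / 2 * frob (Y - Yk) ^+ 2)%:E)%E) V
  | HierarchicalProx => exists2 phi, Phi = Separable phi &
      forall i : 'I_r, is_argmin (fun y : 'cV[R]_n =>
        (phi i y
         + (alpha / 2 * frob (\sum_(j < r | (j < i)%N) col j U *m (col j V)^T
                              + col i U *m y^T
                              + \sum_(j < r | (i < j)%N)
                                  col j U *m (col j Yk)^T
                              - Zk) ^+ 2
            + lam / 2 * frob (col i U - y) ^+ 2
            + sigma / 2 * frob (y - col i Yk) ^+ 2)%:E)%E) (col i V)
  end.

Definition contraction (W : 'M[R]_n) : 'M[R]_n :=
  W - (beta / (alpha + beta)) *: Aadj (A W).

Definition rho : R := opnorm contraction ^+ 2.

Definition Zof (X Y : mat) : 'M[R]_n :=
  contraction (X *m Y^T) + (beta / (alpha + beta)) *: Aadj b.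

Definition mu_max (Yk : mat) : R :=
  (alpha + 2 * gamma * rho) * specnorm Yk ^+ 2 + c.

Definition sigma_cap (U : mat) : R :=
  (alpha + 2 * gamma * rho) * specnorm U ^+ 2 + c.

Definition criterion (Xk Yk : mat) (Rk : \bar R) (U V : mat) : Prop :=
  (objective U V - Rk
   <= (- (c / 2 * (frob (U - Xk) ^+ 2 + frob (V - Yk) ^+ 2)))%:E)%E.

Definition first_pass (Xk Yk : mat) (s : pass R n r) : Prop :=
  exists mu0 sigma0 : R,
    [/\ mu_min T <= mu0, sigma_min T <= sigma0 <= sigma_max T
      & [/\ mu s = Num.min mu0 (mu_max Yk), sigma s = sigma0,
            Uupdate (Uby s) Xk Yk (Zof Xk Yk) (mu s) (candU s)
          & Vupdate (Vby s) (candU s) Yk (Zof Xk Yk) (sigma s) (candV s)]].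

(* The transition after the pass [s] has failed the criterion. Once mu is
   maximal, the candidate U is kept and only sigma and V change. *)
Definition next_pass (Xk Yk : mat) (s s' : pass R n r) : Prop :=
  (if mu s == mu_max Yk then
     [/\ mu s' = mu s, candU s' = candU s, Uby s' = Uby s
       & sigma s' = Num.min (tau T * sigma s) (sigma_cap (candU s))]
   else
     [/\ mu s' = Num.min (tau T * mu s) (mu_max Yk),
         sigma s' = tau T * sigma s
       & Uupdate (Uby s') Xk Yk (Zof Xk Yk) (mu s') (candU s')])
  /\ Vupdate (Vby s') (candU s') Yk (Zof Xk Yk) (sigma s') (candV s').

(* The values of the sequence after a pass that meets the criterion are
   irrelevant: the line search ends there. *)
Definition line_search (Xk Yk : mat) (Rk : \bar R) (s : nat -> pass R n r) :
    Prop :=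
  first_pass Xk Yk (s 0%N) /\
  forall j, (forall i, (i <= j)%N -> ~ criterion Xk Yk Rk (candU (s i)) (candV (s i))) ->
    next_pass Xk Yk (s j) (s j.+1).

(* [iterate k X Y Rk]: the algorithm can reach the k-th outer iteration with
   X^k = X, Y^k = Y and R_k = Rk. *)
Inductive iterate : nat -> mat -> mat -> \bar R -> Prop :=
  | iterate0 X0 Y0 :
      (objective X0 Y0 < +oo)%E -> iterate 0 X0 Y0 (objective X0 Y0)
  | iterateS k Xk Yk Rk s j p :
      iterate k Xk Yk Rk ->
      line_search Xk Yk Rk s ->
      (forall i, (i < j)%N -> ~ criterion Xk Yk Rk (candU (s i)) (candV (s i))) ->
      criterion Xk Yk Rk (candU (s j)) (candV (s j)) ->
      p_min T <= p <= 1 ->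
      iterate k.+1 (candU (s j)) (candV (s j))
        ((1 - p)%:E * Rk + p%:E * objective (candU (s j)) (candV (s j)))%E.

End ANAUM.

(* Main.v *)
(* Write D = E1 + E2 for the increment U V^T - X Y^T, with E1 = (U - X) Y^T and
   E2 = U (V - Y)^T. At Z = Z^k, the gradient of H_alpha is that of the data
   term, so the two updates control the linear part of the objective along E1
   and E2, up to the cross term alpha <E1, E2>. The quadratic part is
   |A D|^2 / 2, and A A^* = I together with 1/alpha + 1/beta = 1 gives
   |A D|^2 <= (alpha + gamma rho) |D|^2. Hence the criterion holds once mu and
   sigma have both reached their caps; since they grow geometrically, this
   happens after finitely many passes. *)
Require Import Defs.
From HB Require Import structures.
From mathcomp Require Import all_boot all_order all_algebra.
From mathcomp Require Import all_classical all_reals all_analysis.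
From mathcomp Require Import ring lra.

Set Implicit Arguments.
Unset Strict Implicit.
Unset Printing Implicit Defensive.

Import Order.TTheory GRing.Theory Num.Theory.
Import numFieldNormedType.Exports.

Local Open Scope classical_set_scope.
Local Open Scope ring_scope.

(** * Frobenius inner product, operator norms and gradients of squared norms *)

Section FrobeniusInnerProduct.
Context {R : realType}.

Lemma mxdotC m n (X Y : 'M[R]_(m, n)) : mxdot X Y = mxdot Y X.
Proof. by rewrite /mxdot -mxtrace_tr trmx_mul trmxK. Qed.

Lemma mxdotDr m n (X Y Z : 'M[R]_(m, n)) :
  mxdot X (Y + Z) = mxdot X Y + mxdot X Z.
Proof. by rewrite /mxdot mulmxDr mxtraceD. Qed.

Lemma mxdotDl m n (X Y Z : 'M[R]_(m, n)) :
  mxdot (X + Y) Z = mxdot X Z + mxdot Y Z.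
Proof. by rewrite mxdotC mxdotDr !(mxdotC Z). Qed.

Lemma mxdotZr m n a (X Y : 'M[R]_(m, n)) : mxdot X (a *: Y) = a * mxdot X Y.
Proof. by rewrite /mxdot -scalemxAr mxtraceZ. Qed.

Lemma mxdotZl m n a (X Y : 'M[R]_(m, n)) : mxdot (a *: X) Y = a * mxdot X Y.
Proof. by rewrite mxdotC mxdotZr mxdotC. Qed.

Lemma mxdotNr m n (X Y : 'M[R]_(m, n)) : mxdot X (- Y) = - mxdot X Y.
Proof. by rewrite -scaleN1r mxdotZr mulN1r. Qed.

Lemma mxdotNl m n (X Y : 'M[R]_(m, n)) : mxdot (- X) Y = - mxdot X Y.
Proof. by rewrite mxdotC mxdotNr mxdotC. Qed.

Lemma mxdot_tr m n (X Y : 'M[R]_(m, n)) : mxdot X^T Y^T = mxdot X Y.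
Proof. by rewrite /mxdot -mxtrace_tr trmx_mul !trmxK mxtrace_mulC. Qed.

Definition mxdotE_bilin := (mxdotDl, mxdotDr, mxdotNl, mxdotNr, mxdotZl, mxdotZr).

Lemma mxdot_ge0 m n (X : 'M[R]_(m, n)) : 0 <= mxdot X X.
Proof.
rewrite mxdotE; apply: sumr_ge0 => i _; apply: sumr_ge0 => j _.
by rewrite -expr2 sqr_ge0.
Qed.

Lemma frob_sq m n (X : 'M[R]_(m, n)) : frob X ^+ 2 = mxdot X X.
Proof. by rewrite sqr_sqrtr ?mxdot_ge0. Qed.

Lemma frob_ge0 m n (X : 'M[R]_(m, n)) : 0 <= frob X.
Proof. exact: sqrtr_ge0. Qed.

Lemma frob0 m n : frob (0 : 'M[R]_(m, n)) = 0.
Proof. by rewrite /frob /mxdot mulmx0 mxtrace0 sqrtr0. Qed.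

Lemma frobN m n (X : 'M[R]_(m, n)) : frob (- X) = frob X.
Proof. by rewrite /frob mxdotNl mxdotNr opprK. Qed.

Lemma frob_tr m n (X : 'M[R]_(m, n)) : frob X^T = frob X.
Proof. by rewrite /frob mxdot_tr. Qed.

Lemma frobZ m n a (X : 'M[R]_(m, n)) : frob (a *: X) = `|a| * frob X.
Proof.
by rewrite /frob mxdotZl mxdotZr mulrA -expr2 sqrtrM ?sqr_ge0// sqrtr_sqr.
Qed.

Lemma normr_le_frob m n (X : 'M[R]_(m, n)) i j : `|X i j| <= frob X.
Proof.
rewrite -(ler_pXn2r (n := 2)) ?nnegrE ?frob_ge0// frob_sq real_normK ?num_real//.
rewrite mxdotE (bigD1 i)//= (bigD1 j)//= -expr2 -addrA lerDl addr_ge0//.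
  by apply: sumr_ge0 => k _; rewrite -expr2 sqr_ge0.
by apply: sumr_ge0 => k _; apply: sumr_ge0 => l _; rewrite -expr2 sqr_ge0.
Qed.

Lemma frob_eq0 m n (X : 'M[R]_(m, n)) : frob X = 0 -> X = 0.
Proof.
move=> X0; apply/matrixP => i j; rewrite mxE; apply/eqP.
by rewrite -normr_le0 -X0 normr_le_frob.
Qed.

Lemma frob_sq_sum_col m n (X : 'M[R]_(m, n)) :
  frob X ^+ 2 = \sum_j frob (col j X) ^+ 2.
Proof.
rewrite frob_sq mxdotE exchange_big /=; apply: eq_bigr => j _.
rewrite frob_sq mxdotE; apply: eq_bigr => i _.
by rewrite big_ord1 mxE.
Qed.

(** Entries of [X] are at most 1 in absolute value when [frob X <= 1], so each entry of [L X] is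
    bounded by summing the images of the basis matrices. This makes the [sup] in [opnorm] a genuine
    least upper bound. *)
Lemma opnorm_has_ubound m n m' n' (L : {linear 'M[R]_(m, n) -> 'M[R]_(m', n')}) :
  has_ubound [set frob (L X) | X in [set X | frob X <= 1]].
Proof.
pose K k l := \sum_i \sum_j `|L (delta_mx i j) k l|.
exists (Num.sqrt (\sum_k \sum_l K k l ^+ 2)) => _ [X /= X1 <-].
apply: ler_wsqrtr; rewrite mxdotE; apply: ler_sum => k _; apply: ler_sum => l _.
rewrite -expr2 -real_normK ?num_real//.
have K_ge0 : 0 <= K k l by apply: sumr_ge0 => i _; apply: sumr_ge0 => j _.
rewrite ler_pXn2r ?nnegrE//.
rewrite {1}(matrix_sum_delta X) linear_sum summxE.
apply: (le_trans (ler_norm_sum _ _ _)); apply: ler_sum => i _.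
rewrite linear_sum summxE.
apply: (le_trans (ler_norm_sum _ _ _)); apply: ler_sum => j _.
rewrite linearZ mxE normrM ler_piMl//.
exact: le_trans (normr_le_frob _ _ _) X1.
Qed.

(** By homogeneity it is enough to evaluate [L] at [X] divided by its norm; [X = 0] is treated
    apart. *)
Lemma frob_le_opnorm m n m' n' (L : {linear 'M[R]_(m, n) -> 'M[R]_(m', n')}) X :
  frob (L X) <= opnorm L * frob X.
Proof.
have [X0|X0] := eqVneq (frob X) 0.
  by rewrite X0 mulr0 (frob_eq0 X0) linear0 frob0.
have Xgt0 : 0 < frob X by rewrite lt0r X0 frob_ge0.
rewrite -ler_pdivrMr// mulrC -[X in X * _]ger0_norm ?invr_ge0 ?frob_ge0//.
rewrite -frobZ -linearZ; apply: ub_le_sup; first exact: opnorm_has_ubound.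
exists ((frob X)^-1 *: X) => //=.
by rewrite frobZ ger0_norm ?invr_ge0 ?frob_ge0// mulVf.
Qed.

(** The squared norm is a sum over columns, and [M] acts on each column of [N] separately. *)
Lemma frob_sq_mulmx_le m n p (M : 'M[R]_(m, n)) (N : 'M[R]_(n, p)) :
  frob (M *m N) ^+ 2 <= specnorm M ^+ 2 * frob N ^+ 2.
Proof.
rewrite !frob_sq_sum_col mulr_sumr; apply: ler_sum => j _.
rewrite !colE -mulmxA -colE -exprMn lerXn2r ?nnegrE ?frob_ge0//.
  by apply: le_trans (frob_le_opnorm _ _); exact: frob_ge0.
exact: (frob_le_opnorm (mulmx M)).
Qed.

(** The difference quotient at [h != 0] is exactly [a + h * b]. *)
Lemma derive_quadratic (V : normedModType R) (f : V -> R) (x v : V) (a b : R) :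
  (forall h, f (h *: v + x) = f x + h * a + h ^+ 2 * b) -> 'D_v f x = a.
Proof.
move=> fE; apply: cvg_lim => //.
apply: (@cvg_trans _ ((fun h : R => a + h * b) @ 0^')).
  apply: near_eq_cvg; near=> h.
  have h0 : h != 0 by near: h; exact: nbhs_dnbhs_neq.
  by rewrite /= fE /GRing.scale /=; field.
have lim_ab : (fun h : R => a + h * b) @ 0^' --> a + 0 * b.
  by apply: cvgD; [exact: cvg_cst | apply: cvgMr_tmp; exact: nbhs_dnbhs].
by rewrite mul0r addr0 in lim_ab.
Unshelve. all: by end_near. Qed.

(** The partial derivative along a basis matrix is the linear coefficient of a quadratic in the
    step. Expanding [D] in the basis then gives the pairing without forming the adjoint of [L]. *)
Lemma mxdot_gradient m n m' n' (L : {linear 'M[R]_(m, n) -> 'M[R]_(m', n')})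
    (a : R) (Z : 'M[R]_(m', n')) (X D : 'M[R]_(m, n)) :
  mxdot (gradient (fun X => a / 2 * frob (L X - Z) ^+ 2) X) D =
  a * mxdot (L X - Z) (L D).
Proof.
have gradE i j : gradient (fun X => a / 2 * frob (L X - Z) ^+ 2) X i j =
    a * mxdot (L X - Z) (L (delta_mx i j)).
  rewrite mxE; apply: (derive_quadratic (b := a / 2 * frob (L (delta_mx i j)) ^+ 2)) => h.
  rewrite linearP -addrA !frob_sq; move: (L X - Z) => W.
  by rewrite !mxdotE_bilin (mxdotC (L _) W); field.
rewrite mxdotE {2}(matrix_sum_delta D) linear_sum /mxdot linear_sum linear_sum.
rewrite mulr_sumr /=.
apply: eq_bigr => i _.
rewrite linear_sum linear_sum linear_sum mulr_sumr/=; apply: eq_bigr => j _.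
by rewrite gradE -/(mxdot _ _) linearZ mxdotZr; ring.
Qed.

End FrobeniusInnerProduct.

(** * Descent inequality of each block update *)

Section Descent.
Context {R : realType}.

Lemma mulmx_sum_col m n p (X : 'M[R]_(m, n)) (Y : 'M[R]_(p, n)) :
  X *m Y^T = \sum_j col j X *m (col j Y)^T.
Proof.
apply/matrixP => i k; rewrite mxE summxE; apply: eq_bigr => j _.
by rewrite !mxE big_ord1 !mxE.
Qed.

(** The difference of the two sides is a/2 |W' - W|^2. *)
Lemma frob_sq_tangent m n (a : R) (W W' Z : 'M[R]_(m, n)) : 0 <= a ->
  a * mxdot (W - Z) (W' - W) <=
  a / 2 * frob (W' - Z) ^+ 2 - a / 2 * frob (W - Z) ^+ 2.
Proof.
move=> a_ge0; have -> : W' - Z = (W' - W) + (W - Z) by rewrite addrA subrK.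
move: (W' - W) (W - Z) => D E.
rewrite !frob_sq !mxdotDl !mxdotDr (mxdotC D E).
by have := mulr_ge0 a_ge0 (mxdot_ge0 D); lra.
Qed.

(** Adjusts the real summands only, so that [a] and [b] may be infinite and are never subtracted.
    The remaining goal is real and suits [lra]. *)
Lemma leeD_shift (a b : \bar R) (x y x' y' : R) :
  (a + x%:E <= b + y%:E)%E -> x' - x <= y' - y ->
  (a + x'%:E <= b + y'%:E)%E.
Proof.
move=> abxy xy; have -> : (a + x'%:E = a + x%:E + (x' - x)%:E)%E.
  by rewrite -addeA -EFinD subrKC.
have -> : (b + y'%:E = b + y%:E + (y' - y)%:E)%E.
  by rewrite -addeA -EFinD subrKC.
by apply: leeD => //; rewrite lee_fin.
Qed.

Section HierarchicalSum.
Variables (n r : nat) (Xk Yk U : 'M[R]_(n, r)).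

(** The product once the first [i] columns are updated; a natural index allows [i = r], the fully
    updated product. *)
Let partial_product (i : nat) : 'M[R]_n :=
  \sum_(j < r) (if (j < i)%N then col j U else col j Xk) *m (col j Yk)^T.

(** Has the shape of the product in the hierarchical case of [Uupdate]. *)
Let hierarchical_product (i : 'I_r) (x : 'cV[R]_n) : 'M[R]_n :=
  \sum_(j < r | (j < i)%N) col j U *m (col j Yk)^T
  + x *m (col i Yk)^T + \sum_(j < r | (i < j)%N) col j Xk *m (col j Yk)^T.

Lemma hierarchical_productE i x : hierarchical_product i x =
  \sum_(j < r) (if (j < i)%N then col j U else
                if j == i then x else col j Xk) *m (col j Yk)^T.
Proof.
rewrite [RHS](bigID (fun j : 'I_r => (j < i)%N)) /=.
rewrite [in RHS](bigD1 (P := fun j : 'I_r => ~~ (j < i)%N) i) ?ltnn//= eqxx addrA.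
congr (_ + _ + _); first by apply: eq_bigr => j ->.
apply: eq_big => [j|j ij]; first by rewrite -leqNgt ltn_neqAle eq_sym andbC.
by rewrite ltnNge (ltnW ij) /= -val_eqE gtn_eqF.
Qed.

(** Putting the new column in slot [i] gives [partial_product i.+1], putting the old one gives
    [partial_product i]. *)
Lemma hierarchical_telescope (f : 'M[R]_n -> R) :
  \sum_(i < r) (f (hierarchical_product i (col i U))
                - f (hierarchical_product i (col i Xk)))
  = f (U *m Yk^T) - f (Xk *m Yk^T).
Proof.
pose u i := f (partial_product i).
transitivity (\sum_(i < r) (u i.+1 - u i)).
  apply: eq_bigr => i _; congr (f _ - f _); rewrite hierarchical_productE;
    apply: eq_bigr => j _; congr (_ *m _).
    by rewrite ltnS -val_eqE /=; case: ltngtP => // /val_inj ->.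
  by case: eqP => [->|//]; case: ifP => //; rewrite ltnn.
rewrite -(big_mkord xpredT (fun i => u i.+1 - u i)) telescope_sumr//.
congr (f _ - f _); rewrite mulmx_sum_col; apply: eq_bigr => j _ //.
by rewrite ltn_ord.
Qed.

End HierarchicalSum.

(* For [alpha >= 0] the exact schemes dominate the linearised one, because
   [H] lies above its tangents. *)
Lemma Uupdate_descent n r q (P : problem R n r q) (T : parameters R) s
    (Xk Yk : 'M[R]_(n, r)) Zk mu (U : 'M[R]_(n, r)) :
  (alpha T < 0 -> s = ProxLinear) -> Uupdate P T s Xk Yk Zk mu U ->
  (Psi P U + (alpha T * mxdot (Xk *m Yk^T - Zk) ((U - Xk) *m Yk^T)
              + lambda P / 2 * frob (U - Yk) ^+ 2
              + mu / 2 * frob (U - Xk) ^+ 2)%:E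
   <= Psi P Xk + (lambda P / 2 * frob (Xk - Yk) ^+ 2)%:E)%E.
Proof.
(* In every case the minimiser is compared with X^k, where the proximal term vanishes. *)
have [_ /(_ isT) ->|alpha_ge0 _] := ltP (alpha T) 0; last case: s.
- move=> /(_ Xk) /leeD_shift; apply.
  rewrite !(mxdot_gradient (mulmxr Yk^T)) /= !subrr mul0mx frob0 expr0n /=.
  by rewrite mulr0 mxdotC /mxdot trmx0 mul0mx mxtrace0; lra.
- move=> /(_ Xk) /leeD_shift; apply.
  have := frob_sq_tangent (Xk *m Yk^T) (U *m Yk^T) Zk alpha_ge0.
  by rewrite /H mulmxBl subrr frob0 expr0n/=; lra.
- move=> /(_ Xk) /leeD_shift; apply.
  rewrite !(mxdot_gradient (mulmxr Yk^T)) /= !subrr mul0mx frob0 expr0n /=.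
  by rewrite mulr0 mxdotC /mxdot trmx0 mul0mx mxtrace0; lra.
- case=> psi -> /= Umin.
  (* Summed over the columns, the quadratic fitting terms telescope to the change of [H] from X^k to
     [U]. *)
  have sum_le := lee_sum (index_enum 'I_r) (fun i (_ : xpredT i) => Umin i (col i Xk)).
  rewrite [leLHS]big_split [leRHS]big_split /= !sumEFin in sum_le.
  apply: (leeD_shift sum_le).
  have := hierarchical_telescope Xk Yk U (fun W => alpha T / 2 * frob (W - Zk) ^+ 2).
  rewrite sumrB !big_split /= -!mulr_sumr => tele.
  have colB (X Y : 'M[R]_(n, r)) :
      \sum_i frob (col i X - col i Y) ^+ 2 = frob (X - Y) ^+ 2.
    by rewrite frob_sq_sum_col; apply: eq_bigr => i _; rewrite linearB.
  rewrite !colB subrr frob0 expr0n /=.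
  have := frob_sq_tangent (Xk *m Yk^T) (U *m Yk^T) Zk alpha_ge0.
  by rewrite -mulmxBl; move: tele; lra.
Qed.

(** Exchanges the two blocks, so that results on U transfer to V. The data enter [Uupdate] only
    through [Zk], which is transposed at the point of use. *)
Definition swap_problem n r q (P : problem R n r q) :=
  MkProblem (Phi P) (Psi P) (opA P) (vecb P) (lambda P).

(** The transpose of U Y^T - Z is Y U^T - Z^T, and the Frobenius norm is invariant under
    transposition and sign change. *)
Lemma Vupdate_swap n r q (P : problem R n r q) (T : parameters R) s
    (U Yk : 'M[R]_(n, r)) Zk sigma (V : 'M[R]_(n, r)) :
  Vupdate P T s U Yk Zk sigma V ->
  Uupdate (swap_problem P) T s Yk U Zk^T sigma V.
Proof.
have frobC (X Y : 'M[R]_(n, r)) : frob (X - Y) = frob (Y - X).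
  by rewrite -frobN opprB.
have HC Y : H T U Y Zk = H T Y U Zk^T.
  by rewrite /H -frob_tr linearB /= trmx_mul trmxK.
case: s => /=.
- by move=> Vmin Y; have := Vmin Y; rewrite !HC !(frobC U).
- move=> Vmin Y; have := Vmin Y.
  have -> : (fun Y' => H T U Y' Zk) = (fun Y' => H T Y' U Zk^T) by apply/funext.
  by rewrite !(frobC U).
- case=> phi PhiE Vmin; exists phi => // i y; have := Vmin i y.
  have trE p (X Y : 'M[R]_(n, r)) : (\sum_(j < r | p j) col j X *m (col j Y)^T)^T =
      \sum_(j < r | p j) col j Y *m (col j X)^T.
    by rewrite linear_sum; apply: eq_bigr => j _; rewrite /= trmx_mul trmxK.
  have frobE x : frob (\sum_(j < r | (j < i)%N) col j U *m (col j V)^T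
      + col i U *m x^T + \sum_(j < r | (i < j)%N) col j U *m (col j Yk)^T - Zk) =
    frob (\sum_(j < r | (j < i)%N) col j V *m (col j U)^T
      + x *m (col i U)^T + \sum_(j < r | (i < j)%N) col j Yk *m (col j U)^T - Zk^T).
    by rewrite -frob_tr linearB !linearD /= trmx_mul trmxK !trE.
  have frobC1 (u v : 'cV[R]_n) : frob (u - v) = frob (v - u).
    by rewrite -frobN opprB.
  by rewrite !frobE !(frobC1 (col i U)).
Qed.

(** The linear term is taken at U Y_k^T, with the new [U]: this is where the cross term between the
    two increments comes from. *)
Lemma Vupdate_descent n r q (P : problem R n r q) (T : parameters R) s
    (U Yk : 'M[R]_(n, r)) Zk sigma (V : 'M[R]_(n, r)) :
  (alpha T < 0 -> s = ProxLinear) -> Vupdate P T s U Yk Zk sigma V ->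
  (Phi P V + (alpha T * mxdot (U *m Yk^T - Zk) (U *m (V - Yk)^T)
              + lambda P / 2 * frob (U - V) ^+ 2
              + sigma / 2 * frob (V - Yk) ^+ 2)%:E
   <= Phi P Yk + (lambda P / 2 * frob (U - Yk) ^+ 2)%:E)%E.
Proof.
move=> sE /Vupdate_swap/(Uupdate_descent sE) /=.
rewrite -mxdot_tr linearB /= !trmx_mul !trmxK.
by rewrite -(frobN (V - U)) -(frobN (Yk - U)) !opprB.
Qed.

End Descent.

(** * Geometric growth below a cap *)

(** If the cap is never attained, the minimum is always [t * u j], and the sequence outgrows [M]. *)
Lemma min_geometric_reaches_cap (R : realType) (u : nat -> R) (t M : R) :
  0 < u 0%N -> 1 < t -> (forall j, u j.+1 = Num.min (t * u j) M) ->
  exists j, u j = M.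
Proof.
move=> u0 t1 uS; apply: contrapT => /forallNP uM.
have uSt j : u j.+1 = t * u j.
  by rewrite uS; case: leP => // /ltW ?; case: (uM j.+1); rewrite uS min_r.
(* A linear lower bound, in the manner of Bernoulli, suffices for the Archimedean argument. *)
have u_ge j : u 0%N + j%:R * ((t - 1) * u 0%N) <= u j.
  elim: j => [|j IHj]; first by rewrite mul0r addr0.
  have jt : 0 <= j%:R * ((t - 1) * u 0%N).
    by rewrite !mulr_ge0 ?subr_ge0 // ltW.
  have : (t - 1) * (u 0%N + j%:R * ((t - 1) * u 0%N)) <= (t - 1) * u j.
    by rewrite ler_pM2l ?subr_gt0.
  have : 0 <= (t - 1) * (j%:R * ((t - 1) * u 0%N)).
    by rewrite mulr_ge0 // subr_ge0 ltW.
  by rewrite uSt -natr1; move: IHj; lra.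
have s_gt0 : 0 < (t - 1) * u 0%N by rewrite mulr_gt0 ?subr_gt0.
(* Only from index 1 on: the starting value may exceed the cap. *)
have u_le j : u j.+1 <= M by rewrite uS ge_min lexx orbT.
have := archi_boundP (normr_ge0 (M / ((t - 1) * u 0%N))).
set j := Num.bound _; rewrite ltNge => /negP; apply.
have := le_trans (u_ge j.+1) (u_le j); rewrite -natr1 => jM.
apply: le_trans (ler_norm _).
by rewrite ler_pdivlMr//; move: jM; lra.
Qed.

(** * Descent of the objective at the capped parameters *)

Section SufficientDescent.
Context {R : realType} {n r q : nat}.
Variables (P : problem R n r q) (T : parameters R).

Local Notation A := (opA P).
Local Notation b := (vecb P).

(** Gives [contraction] the linear structure under which [frob_le_opnorm] bounds it by [rho]. *)
Lemma contraction_is_linear : linear (Defs.contraction P T).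
Proof.
move=> a W W'; apply/matrixP => i j; rewrite !mxE linearP mxdotDr mxdotZr.
by ring.
Qed.

HB.instance Definition _ := GRing.isLinear.Build R 'M[R]_n 'M[R]_n *:%R
  (Defs.contraction P T) contraction_is_linear.

Hypotheses (hA : assumptionA P T) (hT : valid_parameters P T).

Let alpha_neq0 : alpha T != 0. Proof. by case: hA => _ _ []. Qed.
Let beta_neq0 : beta T != 0. Proof. by case: hA => _ _ []. Qed.
Let AadjK w : A (adjoint A w) = w. Proof. by case: hA. Qed.
Let gamma_ge0 : 0 <= gamma T. Proof. by case: hT => _ []. Qed.
Let c_gt0 : 0 < c T. Proof. by case: hT => -[]. Qed.

Let alpha_addE : alpha T + beta T = alpha T * beta T.
Proof.
have [_ _ [_ _ e] _] := hA.
have <- : alpha T * beta T * ((alpha T)^-1 + (beta T)^-1) = alpha T + beta T.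
  by field; rewrite alpha_neq0 beta_neq0.
by rewrite e mulr1.
Qed.

Let beta_invE : (beta T)^-1 = 1 - (alpha T)^-1.
Proof. by have [_ _ [_ _ <-] _] := hA; rewrite addrC addKr. Qed.

(** Hence [contraction] is I - A^* A / alpha. *)
Lemma betaE : beta T / (alpha T + beta T) = (alpha T)^-1.
Proof. by rewrite alpha_addE; field; rewrite alpha_neq0 beta_neq0. Qed.

Lemma rho_ge0 : 0 <= rho P T.
Proof. exact: sqr_ge0. Qed.

(* The gap [alpha |D|^2 - |A D|^2] is the quadratic form of
   [alpha I + beta A^* A] at the contraction of [D]. *)
Lemma frob_sq_opA_le D :
  frob (A D) ^+ 2 <= (alpha T + gamma T * rho P T) * frob D ^+ 2.
Proof.
have [_ [_ /(_ (Defs.contraction P T D))]] := hT.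
have : frob (Defs.contraction P T D) ^+ 2 <= rho P T * frob D ^+ 2.
  rewrite /rho -exprMn lerXn2r ?nnegrE ?frob_ge0//.
    by apply: le_trans (frob_le_opnorm _ _); exact: frob_ge0.
  exact: (frob_le_opnorm (Defs.contraction P T)).
move=> /(ler_wpM2l gamma_ge0).
rewrite mxdotDr !mxdotZr -adjointP -!frob_sq.
(* As A A^* = I, applying [A] to the contraction scales [A D] by 1 - 1/alpha = 1/beta. *)
have AC : A (Defs.contraction P T D) = (beta T)^-1 *: A D.
  rewrite /Defs.contraction linearB linearZ /= AadjK betaE.
  by rewrite beta_invE scalerBl scale1r.
have -> : frob (Defs.contraction P T D) ^+ 2 = frob D ^+ 2
   - 2 * (alpha T)^-1 * frob (A D) ^+ 2 + (alpha T)^-1 ^+ 2 * frob (A D) ^+ 2.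
  rewrite /Defs.contraction betaE !frob_sq !mxdotE_bilin.
  by rewrite (mxdotC _ D) -!adjointP AadjK; ring.
rewrite AC frobZ exprMn real_normK ?num_real//.
set d := frob D ^+ 2; set a := frob (A D) ^+ 2.
(* The part without gamma collapses to alpha d - a; the gamma part is at most gamma rho d. *)
have -> : (alpha T + gamma T) * (d - 2 * (alpha T)^-1 * a + (alpha T)^-1 ^+ 2 * a)
    + beta T * ((beta T)^-1 ^+ 2 * a) =
    alpha T * d - a + gamma T * (d - 2 * (alpha T)^-1 * a + (alpha T)^-1 ^+ 2 * a).
  have -> : beta T * ((beta T)^-1 ^+ 2 * a) = (1 - (alpha T)^-1) * a.
    by rewrite -beta_invE; field.
  by field.
by lra.
Qed.

(** By the choice of Z, alpha (X Y^T - Z) is A^* applied to the residual A(X Y^T) - b. *)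
Lemma mxdot_sub_Zof X Y E :
  alpha T * mxdot (X *m Y^T - Zof P T X Y) E = mxdot (A (X *m Y^T) - b) (A E).
Proof.
rewrite /Zof /Defs.contraction betaE !mxdotE_bilin (mxdotC _ (A E)) (mxdotC b).
by rewrite !adjointP !(mxdotC _ E); field.
Qed.

Hypothesis n_gt0 : (0 < n)%N.

(** Since alpha may be negative, the sign is read off from [frob_sq_opA_le] at a nonzero matrix,
    which exists because [n > 0]. *)
Lemma alpha_gamma_rho_ge0 : 0 <= alpha T + 2 * gamma T * rho P T.
Proof.
pose D : 'M[R]_n := delta_mx (Ordinal n_gt0) (Ordinal n_gt0).
have D_gt0 : 0 < frob D.
  apply: lt_le_trans (normr_le_frob D (Ordinal n_gt0) (Ordinal n_gt0)).
  by rewrite mxE !eqxx normr1.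
have := le_trans (sqr_ge0 _) (frob_sq_opA_le D).
rewrite pmulr_lge0 ?exprn_gt0//.
by have := mulr_ge0 gamma_ge0 rho_ge0; lra.
Qed.

(** Covers [sigma_cap] too, which has the same body. *)
Lemma mu_max_gt0 (Y : 'M[R]_(n, r)) : 0 < mu_max P T Y.
Proof.
by rewrite ltr_wpDl// mulr_ge0 ?alpha_gamma_rho_ge0// sqr_ge0.
Qed.

Lemma objective_descent sU sV (Xk Yk U V : 'M[R]_(n, r)) :
  (alpha T < 0 -> sU = ProxLinear /\ sV = ProxLinear) ->
  Uupdate P T sU Xk Yk (Zof P T Xk Yk) (mu_max P T Yk) U ->
  Vupdate P T sV U Yk (Zof P T Xk Yk) (sigma_cap P T U) V ->
  (objective P U V
     + (c T / 2 * (frob (U - Xk) ^+ 2 + frob (V - Yk) ^+ 2))%:E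
   <= objective P Xk Yk)%E.
Proof.
move=> sE /Uupdate_descent hU /Vupdate_descent hV.
have {}hU := hU (fun a => (sE a).1); have {}hV := hV (fun a => (sE a).2).
(* In the sum, the lambda term at the mixed point (U, Y^k) occurs on both sides and cancels. *)
have := leeD hU hV.
rewrite [leLHS]addeACA [leRHS]addeACA -!EFinD => /leeD_shift sum_le.
rewrite /objective -addeA -EFinD; apply: sum_le.
set E1 := (U - Xk) *m Yk^T; set E2 := U *m (V - Yk)^T.
have E1E : U *m Yk^T = Xk *m Yk^T + E1 by rewrite -mulmxDl subrKC.
have -> : U *m V^T = Xk *m Yk^T + (E1 + E2).
  by rewrite addrA -E1E -mulmxDr -linearD/= subrKC.
(* The second linear term is moved back to X^k Y_k^T, at the price of alpha <E1, E2>. *)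
rewrite mxdot_sub_Zof E1E (addrAC _ E1) [mxdot (_ + E1) _]mxdotDl.
rewrite (mulrDr (alpha T)) mxdot_sub_Zof.
set g := A (Xk *m Yk^T) - b.
rewrite linearD (addrAC _ _ (- b)) -/g; clearbody g.
have -> : frob (g + A (E1 + E2)) ^+ 2 = frob g ^+ 2
    + 2 * (mxdot g (A E1) + mxdot g (A E2)) + frob (A (E1 + E2)) ^+ 2.
  rewrite -mxdotDr -linearD !frob_sq mxdotDl !mxdotDr (mxdotC _ g).
  by ring.
have hadd := frob_sq_opA_le (E1 + E2).
(* Applied to the gamma rho part only, whence the factor 2 in the caps. The alpha part is expanded
   exactly, so that its cross term cancels alpha <E1, E2>. *)
have hpar : frob (E1 + E2) ^+ 2 <= 2 * (frob E1 ^+ 2 + frob E2 ^+ 2).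
  have := mxdot_ge0 (E1 - E2); rewrite !frob_sq !mxdotE_bilin (mxdotC E2 E1); lra.
have hexp : frob (E1 + E2) ^+ 2 = frob E1 ^+ 2 + 2 * mxdot E1 E2 + frob E2 ^+ 2.
  by rewrite !frob_sq !mxdotE_bilin (mxdotC E2 E1); lra.
have {}hpar := ler_wpM2l (mulr_ge0 gamma_ge0 rho_ge0) hpar.
have h1 : frob E1 ^+ 2 <= specnorm Yk ^+ 2 * frob (U - Xk) ^+ 2.
  by rewrite -frob_tr trmx_mul trmxK -(frob_tr (U - Xk)) frob_sq_mulmx_le.
have h2 : frob E2 ^+ 2 <= specnorm U ^+ 2 * frob (V - Yk) ^+ 2.
  by rewrite -(frob_tr (V - Yk)) frob_sq_mulmx_le.
have {}h1 := ler_wpM2l alpha_gamma_rho_ge0 h1.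
have {}h2 := ler_wpM2l alpha_gamma_rho_ge0 h2.
rewrite mulrDl hexp in hadd; rewrite hexp in hpar.
rewrite /mu_max /sigma_cap.
move: hadd hpar h1 h2.
by lra.
Qed.

End SufficientDescent.

(** * Finite reference values that dominate the objective *)

Lemma reg_val_neqNy (R : realType) n r (f : regularizer R n r) X :
  reg_proper_closed_bounded f -> f X != -oo%E.
Proof.
case: f => [f [[]] //|psi psiP] /=.
elim/big_ind: _ => // [x y xN yN|i _]; last by case: (psiP i) => -[].
by rewrite adde_eq_ninfty negb_or xN.
Qed.

Lemma objective_neqNy (R : realType) n r q (P : problem R n r q)
    (T : parameters R) X Y : assumptionA P T -> objective P X Y != -oo%E.
Proof.
move=> [[PsiP PhiP] _ _ _]; rewrite /objective !adde_eq_ninfty !negb_or.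
by rewrite !reg_val_neqNy.
Qed.

Lemma criterion_le (R : realType) n r q (P : problem R n r q)
    (T : parameters R) X Y Rk U V : 0 <= c T -> Rk \is a fin_num ->
  criterion P T X Y Rk U V -> (objective P U V <= Rk)%E.
Proof.
move=> c_ge0 Rk_fin; rewrite /criterion => le_obj.
rewrite -sube_le0 ?Rk_fin ?orbT//; apply: le_trans le_obj _.
by rewrite lee_fin oppr_le0 mulr_ge0 ?divr_ge0 ?addr_ge0 ?sqr_ge0.
Qed.

(** The criterion gives F(X^{k+1}, Y^{k+1}) <= R_k, and R_{k+1} is a convex combination of these two
    values. *)
Lemma iterate_objective_le (R : realType) n r q (P : problem R n r q)
    (T : parameters R) k X Y Rk :
  assumptionA P T -> valid_parameters P T -> iterate P T k X Y Rk ->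
  Rk \is a fin_num /\ (objective P X Y <= Rk)%E.
Proof.
move=> hA [[_ _ _ c_gt0 p_bnd] _]; elim=> {k X Y Rk} [X Y obj_fin|].
  by rewrite fin_numE (objective_neqNy _ _ hA) lt_eqF.
move=> k X Y Rk s j p _ [Rk_fin _] _ _ /(criterion_le (ltW c_gt0) Rk_fin) le_obj.
move=> /andP[p_ge p_le1].
have p_ge0 : 0 <= p by apply: le_trans p_ge; case/andP: p_bnd => /ltW.
move: le_obj (objective_neqNy (candU (s j)) (candV (s j)) hA) Rk_fin.
case: (objective _ _ _) => [F| |] //; case: Rk => [Q| |] //=.
rewrite lee_fin => FQ _ _; rewrite -!EFinM -EFinD fin_numE lee_fin; split=> //.
have := ler_wpM2l (_ : 0 <= 1 - p) FQ; rewrite subr_ge0 => /(_ p_le1).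
by lra.
Qed.

(** * The inner loop as long as no pass meets the criterion *)

Section LineSearch.
Context {R : realType} {n r q : nat}.
Variables (P : problem R n r q) (T : parameters R).
Hypotheses (hA : assumptionA P T) (hT : valid_parameters P T) (n_gt0 : (0 < n)%N).
Variables (Xk Yk : 'M[R]_(n, r)) (s : nat -> pass R n r).
Hypotheses (s0 : first_pass P T Xk Yk (s 0%N))
  (sS : forall j, next_pass P T Xk Yk (s j) (s j.+1)).

Let tau_gt1 : 1 < tau T. Proof. by case: hT => -[]. Qed.
Let tau_gt0 : 0 < tau T. Proof. exact: lt_trans tau_gt1. Qed.

(** Provides a positive start for the growth of [sigma] from whichever pass first sees [mu] at its
    cap. *)
Lemma sigma_gt0 j : 0 < sigma (s j).
Proof.
elim: j => [|j sj_gt0].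
  have [mu0 [sigma0 [_ /andP[+ _] [_ -> _ _]]]] := s0.
  by case: hT => -[_ /andP[? _] _ _ _] _; exact: lt_le_trans.
have [] := sS j; case: ifP => _ [].
  by move=> _ _ _ -> _; rewrite lt_min mulr_gt0 //= mu_max_gt0.
by move=> _ -> _ _; rewrite mulr_gt0.
Qed.

Lemma line_search_mu_max : exists j, mu (s j) = mu_max P T Yk.
Proof.
(* If [mu] never equals its cap, [next_pass] always takes the branch that multiplies [mu] by tau. *)
apply: contrapT => /forallNP mu_neq.
have [|||j] := @min_geometric_reaches_cap R (fun j => mu (s j)) (tau T) (mu_max P T Yk).
- have [mu0 [sigma0 [mu0_ge _ [/= -> _ _ _]]]] := s0.
  rewrite lt_min mu_max_gt0// andbT; apply: lt_le_trans mu0_ge.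
  by case: hT => -[].
- exact: tau_gt1.
- move=> j; have [+ _] := sS j.
  by case: ifPn => [/eqP/mu_neq//|_ []].
- exact: mu_neq.
Qed.

Lemma mu_max_next j : mu (s j) = mu_max P T Yk ->
  [/\ mu (s j.+1) = mu_max P T Yk, candU (s j.+1) = candU (s j),
      Uby (s j.+1) = Uby (s j)
    & sigma (s j.+1) = Num.min (tau T * sigma (s j)) (sigma_cap P T (candU (s j)))].
Proof. by move=> muE; have [+ _] := sS j; rewrite muE eqxx. Qed.

(** A pass that changes only [sigma] and V keeps [mu], [Uby] and [candU], so the minimality of U is
    inherited. *)
Lemma line_search_Uupdate j :
  Uupdate P T (Uby (s j)) Xk Yk (Zof P T Xk Yk) (mu (s j)) (candU (s j)).
Proof.
elim: j => [|j Uj]; first by have [? [? [_ _ []]]] := s0.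
by have [+ _] := sS j; case: ifP => _ [] // -> -> ->.
Qed.

Lemma line_search_Vupdate j :
  Vupdate P T (Vby (s j)) (candU (s j)) Yk (Zof P T Xk Yk) (sigma (s j)) (candV (s j)).
Proof.
case: j => [|j]; first by have [? [? [_ _ []]]] := s0.
by have [] := sS j.
Qed.

(** Once [mu] is at its cap, U is frozen. The cap of [sigma], which depends on U, is then constant,
    and the growth lemma applies a second time. *)
Lemma line_search_caps : exists j,
  mu (s j) = mu_max P T Yk /\ sigma (s j) = sigma_cap P T (candU (s j)).
Proof.
have [j muj] := line_search_mu_max.
have stable i : mu (s (j + i)) = mu_max P T Yk /\
    candU (s (j + i)) = candU (s j).
  elim: i => [|i [mui Ui]]; first by rewrite addn0.
  by rewrite addnS; have [-> -> _ _] := mu_max_next mui.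
have [|||i sigmaE] := @min_geometric_reaches_cap R
  (fun i => sigma (s (j + i))) (tau T) (sigma_cap P T (candU (s j))).
- exact: sigma_gt0.
- exact: tau_gt1.
- move=> i; have [mui Ui] := stable i.
  by rewrite addnS -Ui; have [] := mu_max_next mui.
- by exists (j + i)%N; have [-> ->] := stable i.
Qed.

End LineSearch.

(* [hconcave] is vacuous for alpha > 0. For alpha < 0 the claim fails for the
   schemes [Proximal] and [HierarchicalProx]. *)
Theorem lemma5p2 (R : realType) (n r q : nat)
    (P : problem R n r q) (T : parameters R)
    (hr : (r <= n)%N) (hq : (q <= n ^ 2)%N)
    (hlambda : 0 <= lambda P)
    (hA : assumptionA P T)
    (hT : valid_parameters P T)
    (k : nat) (Xk Yk : 'M[R]_(n, r)) (Rk : \bar R)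
    (hk : iterate P T k Xk Yk Rk)
    (s : nat -> pass R n r)
    (hs : line_search P T Xk Yk Rk s)
    (hconcave : alpha T < 0 ->
       forall j, Uby (s j) = ProxLinear /\ Vby (s j) = ProxLinear) :
  exists j : nat, criterion P T Xk Yk Rk (candU (s j)) (candV (s j)).
Proof.
have [Rk_fin obj_le] := iterate_objective_le hA hT hk.
(* As R_k is finite and at least F(X^k, Y^k), descent from the current objective value implies the
   criterion. *)
have crit j : (objective P (candU (s j)) (candV (s j))
     + (c T / 2 * (frob (candU (s j) - Xk) ^+ 2
                   + frob (candV (s j) - Yk) ^+ 2))%:E <= objective P Xk Yk)%E ->
    criterion P T Xk Yk Rk (candU (s j)) (candV (s j)).
  move=> /le_trans/(_ obj_le) obj_desc.
  rewrite /criterion EFinN -(fineK Rk_fin) leeBlDr// addeC.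
  by rewrite leeBrDr// fineK.
(* For [n = 0] all matrices coincide, and the first pass already succeeds. *)
case: (posnP n) => [n0|n_gt0].
  exists 0%N; apply: crit; have dim0 (X Y : 'M[R]_(n, r)) : X = Y.
    by apply/matrixP => i; have := ltn_ord i; rewrite {2}n0.
  rewrite (dim0 (candU _) Xk) (dim0 (candV _) Yk) !subrr !frob0 expr0n/=.
  by rewrite addr0 mulr0 adde0.
apply: contrapT => /forallNP no_crit.
have [s0 next] := hs.
(* With every pass failing, the guarded transitions of [line_search] hold at every index. *)
have {next} sS j : next_pass P T Xk Yk (s j) (s j.+1) by apply: next.
have [j [muj sigmaj]] := line_search_caps hA hT n_gt0 s0 sS.
apply: (no_crit j); apply: crit; have := line_search_Uupdate s0 sS j; rewrite muj => Uj.
have := line_search_Vupdate s0 sS j; rewrite sigmaj => Vj.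
by apply: objective_descent Uj Vj => // alpha_lt0; exact: hconcave.
Qed.
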